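(* Let $u=u(x_1,\dots,x_k)$ and $v=v(y_1,\dots,y_l)$ be non-commutator words and let $s$ be a positive integer. For $i=1,2,\dots,s$ set $u_i=u(x_{1i},\dots,x_{ki})$, where the variables $x_{ji}$ ($1\le j\le k$, $1\le i\le s$) and $y_1,\dots,y_l$ are all distinct. Then both words $[u_1,\dots,u_s]$ and $[v,u_1,\dots,u_s]$ are concise.
   Context: For a group-word $w=w(x_1,\dots,x_k)$ (an element of the free group on $x_1,\dots,x_k$) and a group $G$, $G_w=\{w(g_1,\dots,g_k): g_i\in G\}$ is the set of $w$-values in $G$, and $w(G)=\langle G_w\rangle$ is the verbal subgroup. A word $w$ is concise if $w(G)$ is finite for every group $G$ such that $G_w$ is finite. A non-commutator word is a word such that the sum of the exponents of some variable involved in it is non-zero. Commutators are $[x,y]=x^{-1}y^{-1}xy$ and are left-normed: $[x_1,\dots,x_s]=[[x_1,\dots,x_{s-1}],x_s]$, with $[x_1]=x_1$. *)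

(* Defs.v *)
From HB Require Import structures.
From mathcomp Require Import all_boot all_algebra.
From mathcomp Require Import classical_sets cardinality.

Set Implicit Arguments.
Unset Strict Implicit.
Unset Printing Implicit Defensive.

Local Open Scope classical_set_scope.
Local Open Scope group_scope.

(* A letter (x, false) stands for x and (x, true) for x^-1; the elements of    *)
(* the free group on X are the sequences of letters in which no letter is      *)
(* immediately followed by its inverse.                                        *)
Section FreeGroup.
Variable X : choiceType.

Definition letter_inv (a : X * bool) : X * bool := (a.1, ~~ a.2).

Definition reduced (s : seq (X * bool)) : bool :=
  sorted (fun a b => b != letter_inv a) s.

Record free_group := FreeGroup {
  fg_seq :> seq (X * bool);
  fg_reduced : reduced fg_seq }.

HB.instance Definition _ := [isSub for fg_seq].
HB.instance Definition _ := [Choice of free_group by <:].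

Definition cons_reduce (a : X * bool) (s : seq (X * bool)) : seq (X * bool) :=
  if s is b :: t then if b == letter_inv a then t else a :: s else [:: a].

Definition fg_mul_seq (s t : seq (X * bool)) : seq (X * bool) :=
  foldr cons_reduce t s.

Definition fg_inv_seq (s : seq (X * bool)) : seq (X * bool) :=
  rev (map letter_inv s).

Lemma letter_invK : involutive letter_inv.
Proof. by case=> x b; rewrite /letter_inv /= negbK. Qed.

Lemma cons_reduce_reduced a s : reduced s -> reduced (cons_reduce a s).
Proof.
case: s => [//|b t] /= rs.
case: ifPn => [_|nba]; first exact: path_sorted rs.
by rewrite /reduced /= nba.
Qed.

Lemma fg_mul_seq_reduced s t : reduced t -> reduced (fg_mul_seq s t).
Proof. by move=> rt; elim: s => //= a s /(cons_reduce_reduced a). Qed.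

Lemma fg_inv_seq_reduced s : reduced s -> reduced (fg_inv_seq s).
Proof.
rewrite /reduced /fg_inv_seq rev_sorted sorted_map.
apply: sub_sorted => a b /=.
by rewrite letter_invK eq_sym.
Qed.

Lemma cons_reduceK a s :
  reduced s -> cons_reduce a (cons_reduce (letter_inv a) s) = s.
Proof.
case: s => [_|b t] /=; first by rewrite eqxx.
rewrite letter_invK; case: (eqVneq b a) => [-> | _] /= rs; last by rewrite eqxx.
by case: t rs => //= c t /andP[/negPf ->].
Qed.

Lemma fg_mul_seq_cons a s z : reduced z ->
  fg_mul_seq (cons_reduce a s) z = cons_reduce a (fg_mul_seq s z).
Proof.
case: s => [//|b t] rz /=; case: eqP => [-> /=|//].
by rewrite cons_reduceK // fg_mul_seq_reduced.
Qed.

Definition fg_mul (v w : free_group) : free_group :=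
  FreeGroup (fg_mul_seq_reduced v (fg_reduced w)).
Definition fg_inv (w : free_group) : free_group :=
  FreeGroup (fg_inv_seq_reduced (fg_reduced w)).
Definition fg_one : free_group := @FreeGroup [::] isT.
Definition fg_gen (x : X) : free_group := @FreeGroup [:: (x, false)] isT.

Lemma fg_mulA : associative fg_mul.
Proof.
move=> u v w; apply: val_inj => /=.
elim: (fg_seq u) => //= a s ->.
by rewrite fg_mul_seq_cons // fg_reduced.
Qed.

Lemma fg_mul1 : left_id fg_one fg_mul.
Proof. by move=> w; apply: val_inj. Qed.

Lemma fg_mulr1 : right_id fg_one fg_mul.
Proof.
case=> s rs; apply: val_inj => /=.
elim: s rs => //= a s IHs rs; rewrite IHs; last exact: path_sorted rs.
by case: s rs {IHs} => //= b s /andP[/negPf ->].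
Qed.

Lemma fg_mulV : left_inverse fg_one fg_inv fg_mul.
Proof.
case=> s rs; apply: val_inj => /= {rs}.
elim: s => //= a s IHs.
by rewrite /fg_inv_seq /= rev_cons /fg_mul_seq foldr_rcons /= letter_invK eqxx.
Qed.

Lemma fg_invK : involutive fg_inv.
Proof.
case=> s rs; apply: val_inj => /=.
by rewrite /fg_inv_seq map_rev revK mapK //; exact: letter_invK.
Qed.

Lemma fg_mulrV : right_inverse fg_one fg_inv fg_mul.
Proof. by move=> w; rewrite -{1}[w]fg_invK fg_mulV. Qed.

HB.instance Definition _ := isGroup.Build free_group
  fg_mulA fg_mul1 fg_mulr1 fg_mulV fg_mulrV.

End FreeGroup.

Section Words.
Variable X : choiceType.
Implicit Type w : free_group X.

Definition word_eval (G : groupType) (g : X -> G) w : G :=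
  \prod_(a <- fg_seq w) (if a.2 then (g a.1)^-1 else g a.1).

Lemma word_eval_gen (G : groupType) (g : X -> G) x :
  word_eval g (fg_gen x) = g x.
Proof. by rewrite /word_eval /= big_seq1. Qed.

Lemma word_evalM (G : groupType) (g : X -> G) :
  {morph word_eval g : v w / v * w}.
Proof.
move=> v w; rewrite /word_eval /=.
elim: (fg_seq v) => [|a s IHs] /=; first by rewrite big_nil mul1g.
rewrite big_cons -mulgA -{}IHs.
case: (fg_mul_seq s w) => [|b t] /=; first by rewrite big_seq1 big_nil mulg1.
case: eqP => [->|_]; last by rewrite big_cons.
by rewrite big_cons /=; case: a.2; rewrite /= ?mulKg ?mulVKg.
Qed.

Definition word_values w (G : groupType) : set G :=
  range (fun g : X -> G => word_eval g w).

Definition exponent_sum (x : X) w : int :=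
  (\sum_(a <- fg_seq w | a.1 == x) (-1) ^+ a.2)%R.

Definition noncommutator w : Prop := exists x, exponent_sum x w <> 0%R.

End Words.

Definition subgroup (G : groupType) (H : set G) : Prop :=
  [/\ H 1, (forall x y, H x -> H y -> H (x * y)) & (forall x, H x -> H x^-1)].

Definition generated_subgroup (G : groupType) (A : set G) : set G :=
  smallest (@subgroup G) A.

Definition verbal_subgroup (X : choiceType) (w : free_group X)
    (G : groupType) : set G :=
  generated_subgroup (word_values w (G := G)).

Definition concise (X : choiceType) (w : free_group X) : Prop :=
  forall G : groupType,
    finite_set (word_values w (G := G)) ->
    finite_set (verbal_subgroup w (G := G)).

(* [x_1, ..., x_s] = [~ .. [~ x_1, x_2] .., x_s]. The empty commutator is set  *)
(* to 1.                                                                       *)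
Definition left_normed (G : groupType) (xs : seq G) : G :=
  if xs is x :: xs' then foldl (@commg G) x xs' else 1.

(* Main.v *)
(* Let W be the set of values of [b, a_1, ..., a_s], where b and the a_i range
   over the values of non-commutator words, so that b and each a_i may be any
   e-th power of an element of G. If W is finite then so is L = <W> as soon as
   every element of W is torsion (Dietzmann). Let Z be the centre of L. For z in
   Z, commutation with a is multiplicative on powers of z, and
   [z^(en), a, ..., a] lies in W for all n, so [z, a, ..., a] is torsion; as some
   power of a centralizes L, already [z, a] is torsion. Now take l = [x, a] in W
   with x a value for s - 1. Since [x, a^(en)] lies in the finite set W, x
   commutes with some a^M, hence the product of the conjugates l^(a^i), i < M,
   is 1. As Z has finite index in L, the transfer L -> Z allows one to compute
   in this product as if L were abelian: up to a power all these conjugates have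
   the same image, so l is torsion. *)
Require Import Defs.
From mathcomp Require Import all_boot all_algebra.
From mathcomp Require Import boolp classical_sets cardinality.
From mathcomp Require Import zify.

Set Implicit Arguments.
Unset Strict Implicit.
Unset Printing Implicit Defensive.

Local Open Scope classical_set_scope.
Local Open Scope group_scope.

(** * Counting in finite sets *)

Lemma finite_pigeonhole (T : Type) (A : set T) (f : nat -> T) :
  finite_set A -> (forall n, A (f n)) ->
  exists i j : nat, (i < j)%N /\ f i = f j.
Proof.
move=> finA Af; apply: contrapT => noij.
have f_inj : {in [set: nat] &, injective f}.
  move=> i j _ _ fij; case: (ltngtP i j) => // ij; exfalso; apply: noij.
    by exists i, j.
  by exists j, i.
apply: infinite_nat.
rewrite -(eq_finite_set (inj_card_eq f_inj)).
by apply: sub_finite_set finA => _ [n _ <-].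
Qed.

(** As [P] is stable under multiples, the product of the exponents found along an enumeration of [W]
    serves every element. *)
Lemma finite_uniform_exponent (T : eqType) (W : set T) (P : T -> nat -> Prop) :
  finite_set W ->
  (forall x m n, P x m -> P x (m * n)%N) ->
  (forall x, W x -> exists2 n, (0 < n)%N & P x n) ->
  exists2 n, (0 < n)%N & forall x, W x -> P x n.
Proof.
move=> /finite_seqP[s ->] PM; elim: s => [|x s IHs] Ps; first by exists 1%N.
have [|n n0 Pn] := IHs; first by move=> y ys; apply: Ps; rewrite /= inE ys orbT.
have [m m0 Pm] := Ps x (mem_head _ _).
exists (m * n)%N => [|y]; first by rewrite muln_gt0 m0.
rewrite /= inE => /orP[/eqP->|ys]; first exact: PM.
by rewrite mulnC; apply/PM/Pn.
Qed.

(** Read contrapositively: a long enough product over [ws] has a factor occurring more than [e]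
    times. *)
Lemma size_leq_counts (T : eqType) (ws s : seq T) e :
  {subset s <= ws} -> (forall x, count_mem x s <= e)%N ->
  (size s <= size ws * e)%N.
Proof.
elim: ws s => [|w ws IHws] s sws le_e.
  by case: s sws {le_e} => // x s /(_ x (mem_head _ _)).
rewrite -(count_predC (pred1 w) s) mulSn leq_add // -size_filter.
apply: IHws => [x|x].
  by rewrite mem_filter /= => /andP[xw /sws]; rewrite inE (negPf xw).
by rewrite count_filter (leq_trans _ (le_e x)) // sub_count // => y /= /andP[].
Qed.

(** * Commutators of powers *)

Section CommutatorPowers.
Variable G : groupType.
Implicit Types x y z a : G.

(** Conjugation by [a] multiplies [x] by [[~ x, a]], which [a] fixes, so each further conjugation
    contributes the same factor. *)
Lemma commgX_commute x a n :
  commute a [~ x, a] -> [~ x, a ^+ n] = [~ x, a] ^+ n.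
Proof.
move=> ca; suff : x ^ (a ^+ n) = x * [~ x, a] ^+ n.
  by rewrite (commgEl x (a ^+ n)) => ->; rewrite mulKg.
elim: n => [|n IHn]; first by rewrite conjg1 mulg1.
have xa : x ^ a = x * [~ x, a] by rewrite commgEl mulVKg.
rewrite expgSr conjgM IHn conjMg conjXg expgS mulgA xa; congr (_ * _ ^+ n).
by apply/eqP; rewrite conjg_fix; apply/commgP/commute_sym.
Qed.

Lemma commXg_commute x a n :
  commute x (x ^ a) -> [~ x ^+ n, a] = [~ x, a] ^+ n.
Proof.
move=> cx; have cVx : commute x^-1 (x ^ a).
  exact/commute_sym/commuteV/commute_sym.
by rewrite !commgEl conjXg (expgMn _ cVx) expVgn.
Qed.

Lemma commgM_conj x y z : [~ x, y * z] = [~ x, z] * [~ x, y] ^ z.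
Proof.
by rewrite !commgEl conjgM (conjMg x^-1) conjVg -(mulgA x^-1) mulVKg.
Qed.

End CommutatorPowers.

(** * Torsion, generated subgroups and Dietzmann's lemma *)

Section Torsion.
Variable G : groupType.
Implicit Types (x y : G) (A W : set G).

Definition torsion x := exists2 n, (0 < n)%N & x ^+ n = 1.

Definition conj_closed A := forall x y, A x -> A (x ^ y).

Lemma torsion_finite_powers A x e : finite_set A -> (0 < e)%N ->
  (forall n, A (x ^+ (e * n))) -> torsion x.
Proof.
move=> finA e0 /(finite_pigeonhole finA)[i [j [ij eq_ij]]].
exists (e * (j - i))%N; first by rewrite muln_gt0 e0 subn_gt0.
by rewrite mulnBr expgnFr ?leq_mul2l ?(ltnW ij) ?orbT // eq_ij divgg.
Qed.

Lemma commute_finite_conj A x y e : finite_set A -> (0 < e)%N ->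
  (forall n, A (x ^ (y ^+ (e * n)))) ->
  exists2 k, (0 < k)%N & commute x (y ^+ k).
Proof.
move=> finA e0 /(finite_pigeonhole finA)[i [j [ij eq_ij]]].
exists (e * (j - i))%N; first by rewrite muln_gt0 e0 subn_gt0.
apply/commgP; rewrite -conjg_fix mulnBr expgnFr ?leq_mul2l ?(ltnW ij) ?orbT //.
by rewrite conjgM -eq_ij -conjgM divgg conjg1.
Qed.

Lemma mem_generated W x : W x -> generated_subgroup W x.
Proof. exact: sub_gen_smallest. Qed.

Lemma subgroup_generated W : subgroup (generated_subgroup W).
Proof.
split.
- by move=> H [[]].
- move=> x y Lx Ly H HW; case: (HW) => -[_ HM _] _.
  by apply: HM; [exact: Lx|exact: Ly].
- by move=> x Lx H HW; case: (HW) => -[_ _ HV] _; apply: HV; exact: Lx.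
Qed.

Lemma subgroupX (H : set G) x n : subgroup H -> H x -> H (x ^+ n).
Proof.
case=> H1 HM _ Hx; elim: n => // n IHn; rewrite expgS; exact: HM.
Qed.

Lemma generated_conj W : conj_closed W -> conj_closed (generated_subgroup W).
Proof.
move=> WJ x y.
apply: (@smallest_sub _ _ _ [set z | generated_subgroup W (z ^ y)]).
  have [L1 LM LV] := subgroup_generated W.
  split => /= [|u v Lu Lv|u Lu]; first by rewrite conj1g.
    by rewrite conjMg; exact: LM.
  by rewrite conjVg; exact: LV.
by move=> u Wu /=; exact: mem_generated (WJ _ _ Wu).
Qed.

Lemma generated_commute W y :
  (forall w, W w -> commute w y) ->
  forall x, generated_subgroup W x -> commute x y.
Proof.
move=> Wy; apply: smallest_sub => //; split => [|u v|u] /=.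
- exact/commute_sym/commute1.
- by move=> /commute_sym uy /commute_sym vy; apply/commute_sym/commuteM.
- by move=> /commute_sym uy; apply/commute_sym/commuteV.
Qed.

(** Conjugation by [g] maps the finite set [W] to itself, so each [w] commutes with some power of
    [g]; a common multiple of the exponents works for all generators. *)
Lemma conj_power_centralizes W g : finite_set W -> conj_closed W ->
  exists2 k, (0 < k)%N &
    forall x, generated_subgroup W x -> commute x (g ^+ k).
Proof.
move=> finW WJ.
have [w m n|w Ww|k k0 Wk] :=
  @finite_uniform_exponent _ W (fun w k => commute w (g ^+ k)) finW.
- by rewrite expgnA; apply: commuteX.
- by apply: (commute_finite_conj finW (e := 1)) => // n; exact: WJ.
by exists k => //; apply: generated_commute.
Qed.

(** Moving [w] to the left past [x] replaces [x] by a conjugate, which is again in [W]. *)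
Lemma prod_extract W (s : seq G) w m :
  conj_closed W -> (forall x, x \in s -> W x) -> (m <= count_mem w s)%N ->
  exists s' : seq G, [/\ forall x, x \in s' -> W x, size s = (m + size s')%N &
    \prod_(x <- s) x = w ^+ m * \prod_(x <- s') x].
Proof.
move=> WJ; elim: s m => [|x s IHs] [|m] // Ws le_m.
- by exists [::]; split; rewrite ?mul1g.
- by exists (x :: s); split; rewrite ?mul1g.
have /IHs{}IHs y : y \in s -> W y by move=> ys; apply: Ws; rewrite inE ys orbT.
move: le_m => /=; case: eqP => [->|_] le_m.
  have [s' [Ws' sz eq_s]] := IHs m le_m.
  by exists s'; split => //=; rewrite ?sz // big_cons eq_s expgS mulgA.
have [s' [Ws' sz eq_s]] := IHs m.+1 le_m.
exists (x ^ (w ^+ m.+1) :: s'); split => [y||] /=; last 1 first.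
- by rewrite !big_cons eq_s (mulgA x) (conjgC x) -(mulgA (w ^+ _)).
- by rewrite inE => /orP[/eqP->|/Ws'//]; apply/WJ/Ws/mem_head.
- by rewrite sz addnS.
Qed.

Fixpoint products_leq W n : set G :=
  if n is n'.+1 then [set x * y | x in 1 |` W & y in products_leq W n']
  else [set 1].

Lemma products_leq_finite W n : finite_set W -> finite_set (products_leq W n).
Proof.
move=> finW; elim: n => [|n IHn] /=; first exact: finite_set1.
by apply: finite_image2 => //; rewrite finite_setU; split.
Qed.

Lemma products_leq_prod W (s : seq G) n : (forall x, x \in s -> W x) ->
  (size s <= n)%N -> products_leq W n (\prod_(x <- s) x).
Proof.
elim: n s => [|n IHn] [|x s] //= Ws le_n; rewrite ?big_nil ?big_cons //.
  exists 1; first by left.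
  by exists 1; rewrite ?mulg1 //; have := IHn [::]; rewrite big_nil; apply.
exists x; first by right; apply/Ws/mem_head.
exists (\prod_(y <- s) y) => //; apply: IHn => // y ys.
by apply: Ws; rewrite inE ys orbT.
Qed.

(* If w occurs e times in a product, then w ^+ e = 1 can be collected on the
   left at the cost of conjugating the other factors. *)
Lemma Dietzmann W : finite_set W -> conj_closed W ->
  (forall x, W x -> torsion x) -> finite_set (generated_subgroup W).
Proof.
move=> finW WJ tW.
have [||e e0 We] := @finite_uniform_exponent _ W (fun x n => x ^+ n = 1) finW.
- by move=> x m n xm; rewrite expgnA xm expg1n.
- exact: tW.
have /finite_seqP[ws eqW] := finW.
pose P x := exists s : seq G,
  (forall y, y \in s -> W y) /\ x = \prod_(y <- s) y.
have subP : subgroup P.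
  have PM x y : P x -> P y -> P (x * y).
    move=> [s [Ws ->]] [t [Wt ->]]; exists (s ++ t); rewrite big_cat.
    by split => // z; rewrite mem_cat => /orP[/Ws|/Wt].
  have P1 : P 1 by exists [::]; rewrite big_nil.
  split => // x [s [+ ->]]; elim: s => [|w s IHs] Ws.
    by rewrite big_nil invg1.
  rewrite big_cons invgM; apply: PM.
    by apply: IHs => y ys; apply: Ws; rewrite inE ys orbT.
  have Ww := Ws _ (mem_head _ _).
  (* Torsion turns inverses into positive powers, so products of elements of [W] already form a
     subgroup. *)
  suff -> : w^-1 = w ^+ e.-1.
    exists (nseq e.-1 w); split; last by rewrite big_nseq iter_mulg_1.
    by move=> y; rewrite mem_nseq => /andP[_ /eqP->].
  by apply: mulg1_eq; rewrite -expgS prednK // We.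
have LP : generated_subgroup W `<=` P.
  apply: smallest_sub => // x Wx; exists [:: x]; rewrite big_seq1.
  split => // y.
  by rewrite inE => /eqP->.
apply: sub_finite_set (products_leq_finite (size ws * e) finW) => x /LP.
case=> s [Ws ->]; have [n le_n] := ubnP (size s).
elim: n => // n IHn in s Ws le_n *.
have [le_s|lt_s] := leqP (size s) (size ws * e); first exact: products_leq_prod.
have [w] : exists w, (e <= count_mem w s)%N.
  apply: contrapT => noe; move: lt_s; rewrite ltnNge => /negP; apply.
  apply: size_leq_counts => w; first by move=> /Ws; rewrite eqW.
  by rewrite leqNgt; apply/negP => /ltnW ew; apply: noe; exists w.
move=> we; have [s' [Ws' sz ->]] := prod_extract WJ Ws we.
have Ww : W w.
  by apply: Ws; rewrite -has_pred1 has_count (leq_trans e0).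
rewrite We // mul1g; apply: IHn => //.
by move: le_n; rewrite sz; lia.
Qed.

End Torsion.

(** * Transfer into a central subgroup of finite index *)

Lemma perm_prodg (G : groupType) (I : eqType) (r1 r2 : seq I) (F : I -> G) :
  (forall i j, i \in r1 -> j \in r1 -> commute (F i) (F j)) ->
  perm_eq r1 r2 -> \prod_(i <- r1) F i = \prod_(i <- r2) F i.
Proof.
elim: r1 r2 => [|i r1 IHr] r2 cF.
  by rewrite perm_sym => /perm_nilP->.
move=> perm12; have: i \in r2 by rewrite -(perm_mem perm12) mem_head.
move: perm12 => /[swap] /path.splitPr[p1 p2] perm12.
have cp1 : commute (F i) (\prod_(j <- p1) F j).
  rewrite big_seq; apply: commute_prod => j jp1.
  apply: cF; first exact: mem_head.
  by rewrite (perm_mem perm12) mem_cat jp1.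
rewrite big_cons big_cat big_cons /= mulgA -cp1.
rewrite -mulgA -big_cat; congr (_ * _); apply: IHr.
  by move=> j k jr kr; apply: cF; rewrite inE ?jr ?kr orbT.
rewrite -(perm_cons i) (perm_trans perm12) //.
by rewrite perm_catC /= perm_cons perm_catC.
Qed.

(* The finite index of Z in H is expressed by rho, whose fibres on H are the
   cosets of Z. *)
Lemma central_transfer (G : groupType) (H Z : set G)
    (I : finType) (rho : G -> I) :
  subgroup H -> subgroup Z -> Z `<=` H ->
  (forall z x, Z z -> H x -> commute z x) ->
  (forall x y, H x -> H y -> rho x = rho y <-> Z (x * y^-1)) ->
  exists V : G -> G, exists n, [/\ (0 < n)%N,
    forall x y, H x -> H y -> V (x * y) = V x * V y,
    forall x, H x -> Z (V x) &
    forall z, Z z -> V z = z ^+ n].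
Proof.
move=> sH [Z1 ZM ZV] ZH cZ rhoE; have [H1 HM HV] := sH.
(* [t] picks a representative in [H] of each coset; labels outside the image of [H] are discarded by
   [r]. *)
have [i|t tP] := @boolp.choice I G
    (fun i g => (exists2 x, H x & rho x = i) -> H g /\ rho g = i).
  have [[x Hx rx]|no] := pselect (exists2 x, H x & rho x = i).
    by exists x.
  by exists 1.
pose r := [seq i <- enum I | `[<exists2 x, H x & rho x = i>]].
have rP i : i \in r -> H (t i) /\ rho (t i) = i.
  by rewrite mem_filter => /andP[/asboolP/tP].
have rho_r x : H x -> rho x \in r.
  by move=> Hx; rewrite mem_filter mem_enum andbT; apply/asboolP; exists x.
have Ht i : i \in r -> H (t i) by case/rP.
(* Right multiplication by [x] sends coset [i] to coset [s x i], with discrepancy [c x i] in [Z];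
   the transfer is the product of these discrepancies. *)
pose s x i := rho (t i * x).
pose c x i := t i * x * (t (s x i))^-1.
have s_r x i : H x -> i \in r -> s x i \in r.
  by move=> Hx ir; apply/rho_r/HM => //; apply: Ht.
have cE x i : c x i * t (s x i) = t i * x by rewrite /c mulgVK.
have Zc x i : H x -> i \in r -> Z (c x i).
  move=> Hx ir; have sr := s_r x i Hx ir.
  by apply/rhoE; [exact: HM (Ht i ir) Hx|exact: Ht|have [_ ->] := rP _ sr].
have s_perm x : H x -> perm_eq (map (s x) r) r.
  move=> Hx; have r_uniq : uniq r by rewrite filter_uniq // enum_uniq.
  have s_inj : {in r &, injective (s x)}.
    move=> i j ir jr /rhoE-/(_ (HM _ _ (Ht i ir) Hx) (HM _ _ (Ht j jr) Hx)).
    rewrite invgM mulgA mulgK => /rhoE-/(_ (Ht i ir) (Ht j jr)).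
    by have [_ ->] := rP i ir; have [_ ->] := rP j jr.
  have ms_uniq : uniq (map (s x) r) by rewrite map_inj_in_uniq.
  have sub_r : {subset map (s x) r <= r} by move=> _ /mapP[i ir ->]; apply: s_r.
  apply: uniq_perm => //; apply: (uniq_min_size ms_uniq sub_r _).2.
  by rewrite size_map.
exists (fun x => \prod_(i <- r) c x i), (size r); split.
- by have := rho_r 1 H1; case: (r).
- move=> x y Hx Hy.
  (* Reindexing by the permutation [s x] reduces multiplicativity to the cocycle identity
     [c (x * y) i = c x i * c y (s x i)]. *)
  have -> : \prod_(i <- r) c y i = \prod_(i <- r) c y (s x i).
    rewrite -(big_map (s x) xpredT (c y)); apply/perm_prodg; last first.
      by rewrite perm_sym s_perm.
    by move=> i j ir jr; apply: cZ; [exact: Zc|apply: ZH; exact: Zc].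
  rewrite big_seq [X in _ = X * _]big_seq [X in _ = _ * X]big_seq.
  rewrite -prodgM_commute => [|i j ir jr]; last first.
    by apply: cZ; [exact: Zc|apply/ZH/Zc => //; exact: s_r].
  apply: eq_bigr => i ir.
  have Hix : H (t i * x) by apply: HM => //; apply: Ht.
  have sxy : s (x * y) i = s y (s x i).
    apply/rhoE.
    + by apply: (HM _ _ _ (HM _ _ Hx Hy)); exact: Ht.
    + by apply: HM => //; apply/Ht/s_r.
    rewrite !mulgA invgM mulgA mulgK; exact: Zc.
  by rewrite /c sxy !mulgA mulgVK.
- move=> x Hx; rewrite big_seq; elim/big_ind: _ => // i ir; exact: Zc.
move=> z Zz; rewrite (eq_big_seq (fun=> z)).
  by rewrite big_const_seq count_predT iter_mulg_1.
move=> i ir; have [Hi ri] := rP i ir.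
(* An element of [Z] fixes every coset, so each of the [size r] factors is [z]. *)
have si : s z i = i.
  rewrite -[RHS]ri; apply/rhoE => //; first by apply: HM => //; exact: ZH.
  by rewrite -(cZ z) // mulgK.
by rewrite /c si -(cZ z) // mulgK.
Qed.

(** * The centre of [L] and torsion of the generators *)

Section Center.
Variables (G : groupType) (W : set G).
Hypotheses (finW : finite_set W) (WJ : conj_closed W).
Let L := generated_subgroup W.

Definition center (H : set G) : set G :=
  [set z | H z /\ forall x, H x -> commute z x].

Let Z := center L.

Lemma center_subgroup : subgroup Z.
Proof.
have [L1 LM LV] := subgroup_generated W.
split => [|x y [Lx cx] [Ly cy]|x [Lx cx]].
- by split => // x _; apply/commute_sym/commute1.
- split; first exact: LM.
  move=> z Lz; apply/commute_sym/commuteM; apply/commute_sym.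
    exact: cx.
  exact: cy.
- by split; [exact: LV|move=> z Lz; apply/commute_sym/commuteV/commute_sym/cx].
Qed.

(** Conjugation by [g] restricts to an automorphism of [L], and automorphisms preserve the
    centre. *)
Lemma center_conj : conj_closed Z.
Proof.
move=> z g [Lz cz]; split => [|x Lx]; first exact: generated_conj.
have := cz (x ^ g^-1) (generated_conj WJ _ Lx).
rewrite /commute => /(congr1 (conjg^~ g)).
by rewrite (conjMg z) (conjMg (x ^ g^-1)) conjgKV.
Qed.

Lemma center_commute x y : Z x -> Z y -> commute x y.
Proof. by move=> [_ cx] [Ly _]; apply: cx. Qed.

Lemma center_comm z a : Z z -> Z [~ z, a].
Proof.
move=> Zz; have [_ ZM ZV] := center_subgroup.
by apply: (ZM); [exact: ZV|exact: center_conj].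
Qed.

Lemma center_iter_comm n z a : Z z -> Z (iter n (@commg G ^~ a) z).
Proof. by move=> Zz; elim: n => //= n; apply: center_comm. Qed.

Lemma center_commXg z a n : Z z -> [~ z ^+ n, a] = [~ z, a] ^+ n.
Proof.
by move=> Zz; apply/commXg_commute/center_commute => //; apply: center_conj.
Qed.

Lemma center_iter_commX n z a m : Z z ->
  iter n (@commg G ^~ a) (z ^+ m) = iter n (@commg G ^~ a) z ^+ m.
Proof.
move=> Zz; elim: n => //= n ->; exact/center_commXg/center_iter_comm.
Qed.

(* A power of a centralizes L, so a acts on the centre with finite order: up to
   torsion, a unipotent action of this kind is trivial. *)
Lemma torsion_comm_comm z a : Z z -> torsion [~ [~ z, a], a] -> torsion [~ z, a].
Proof.
move=> Zz [t t0 zaat]; have [k k0 Lk] := conj_power_centralizes a finW WJ.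
have Zzt : Z (z ^+ t) by apply: subgroupX => //; exact: center_subgroup.
exists (t * k)%N; first by rewrite muln_gt0 t0.
(* [[~ z ^+ t, a]] commutes with [a], so [[~ z, a] ^+ (t * k)] equals [[~ z ^+ t, a ^+ k]], which is
   trivial because [a ^+ k] centralizes [L]. *)
rewrite expgnA -center_commXg // -commgX_commute.
  by apply/eqP/commgP/Lk; case: Zzt.
apply/commute_sym/commgP; rewrite center_commXg // center_commXg ?zaat //.
exact: center_comm.
Qed.

Lemma torsion_comm_iter n z a : Z z ->
  torsion (iter n.+1 (@commg G ^~ a) z) -> torsion [~ z, a].
Proof.
move=> Zz; elim: n => //= n IHn tz; apply/IHn/torsion_comm_comm => //.
exact: center_iter_comm.
Qed.

(** [Z] is the kernel of the conjugation action of [L] on the finite set [W]; [rho] records the map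
    induced on [W], as positions in an enumeration. *)
Lemma finite_center_cosets : exists (I : finType) (rho : G -> I),
  forall x y, L x -> L y -> rho x = rho y <-> Z (x * y^-1).
Proof.
have /finite_seqP[s eqW] := finW.
have Ws x : W x <-> x \in s by rewrite eqW.
(* The successor keeps the codomain inhabited, as [inord] requires, even when [s] is empty. *)
exists {ffun 'I_(size s) -> 'I_(size s).+1}.
exists (fun x => [ffun i : 'I_(size s) => inord (index (nth 1 s i ^ x) s)]).
have [L1 LM LV] := subgroup_generated W.
move=> x y Lx Ly; split => [eq_xy|[Lz cz]].
  split; first by apply: LM => //; exact: LV.
  move=> z Lz; apply/commute_sym; move: z Lz.
  apply: generated_commute => w /Ws ws.
  have i_lt : (index w s < size s)%N by rewrite index_mem.
  have /(congr1 val) := congr1 (fun f : {ffun _ -> _} => f (Ordinal i_lt)) eq_xy.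
  rewrite !ffunE /= nth_index // !inordK ?ltnS ?index_size // => eq_i.
  have wJs g : w ^ g \in s by apply/Ws/WJ/Ws.
  have eq_w : w ^ x = w ^ y.
    by rewrite -[LHS](nth_index 1 (wJs x)) eq_i nth_index.
  by apply/commgP; rewrite -conjg_fix conjgM eq_w conjgK.
apply/ffunP => i; rewrite !ffunE; congr (inord (index _ _)).
have Lw : L (nth 1 s i) by apply: mem_generated; apply/Ws; exact: mem_nth.
rewrite -[in LHS](mulgVK y x) conjgM; congr (_ ^ y).
by apply/eqP; rewrite conjg_fix; apply/commgP/commute_sym/cz.
Qed.

Lemma torsion_generator x a e : (0 < e)%N ->
  (forall n, W [~ x, a ^+ (e * n)]) -> W [~ x, a] ->
  (forall z, Z z -> torsion [~ z, a]) -> torsion [~ x, a].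
Proof.
move=> e0 Wxan Wxa tZ; set l := [~ x, a].
have Ll : L l by exact: mem_generated.
have [I [rho rhoE]] := finite_center_cosets.
have sL := subgroup_generated W; have sZ := center_subgroup.
have [V [n [n0 VM VZ Vz]]] := central_transfer sL sZ (fun z => @proj1 _ _)
  (fun z y Zz Ly => Zz.2 y Ly) rhoE.
have V1 : V 1 = 1 by have [Z1 _ _] := sZ; rewrite Vz // expg1n.
have VX y m : L y -> V (y ^+ m) = V y ^+ m.
  move=> Ly; elim: m => // m IHm; rewrite !expgS VM ?IHm //.
  exact: (subgroupX _ sL).
have [N N0 LN] := conj_power_centralizes l finW WJ.
have ZlN : Z (l ^+ N).
  by split=> [|y Ly]; [exact: (subgroupX _ sL)|exact/commute_sym/LN].
have [t t0 lt] := tZ _ ZlN.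
(* The conjugates of [x] by the powers [a ^+ (e * m)] are [x * [~ x, a ^+ (e * m)]], hence lie in
   the finite translate of [W] by [x]. *)
have [M M0 xM] : exists2 M, (0 < M)%N & commute x (a ^+ M).
  apply: (commute_finite_conj (A := [set x * w | w in W]) _ e0).
    exact: finite_image.
  by move=> m; exists [~ x, a ^+ (e * m)]; rewrite // commgEl mulVKg.
(* [N] makes [l ^+ N] central and [t] kills [[~ l ^+ N, a]], so [l ^+ K] is central and commutes
   with [a]; its transfer is [q]. *)
pose K := (N * t)%N; pose q := l ^+ (K * n).
have qa : commute q a.
  apply/commgP; rewrite /q /K !expgnA center_commXg; last exact: (subgroupX _ sZ).
  by rewrite center_commXg // lt expg1n.
have VlJ m : V (l ^ (a ^+ m)) ^+ K = q.
  have LlJ : L (l ^ (a ^+ m)) by exact: generated_conj.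
  rewrite -VX // -conjXg Vz; last first.
    by apply: center_conj; rewrite expgnA; exact: (subgroupX _ sZ).
  rewrite -conjXg -expgnA; apply/eqP; rewrite conjg_fix; apply/commgP.
  exact: commuteX.
(* Each step multiplies the commutator by the conjugate [l ^ (a ^+ m)], whose transfer has [K]-th
   power [q]; transfers commute, so [K]-th powers multiply. *)
have VxaX m : L [~ x, a ^+ m] /\ V [~ x, a ^+ m] ^+ K = q ^+ m.
  elim: m => [|m [Lm Vm]].
    by rewrite commg1 V1 expg1n; split => //; case: sL.
  have LlJ : L (l ^ (a ^+ m)) by exact: generated_conj.
  rewrite expgS commgM_conj; split; first by have [_ LM _] := sL; apply: LM.
  rewrite VM // expgMn ?Vm ?VlJ -?expgSr //.
  by apply: center_commute; apply: VZ.
(* At [m = M] the commutator is 1, so [q ^+ M = 1]. *)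
exists (K * n * M)%N; first by rewrite !muln_gt0 N0 t0 n0.
rewrite expgnA -/q; have [_ <-] := VxaX M.
by have /commgP/eqP-> := xM; rewrite V1 expg1n.
Qed.

End Center.

(** * Sets of left-normed commutators *)

Section CommutatorValues.
Variable G : groupType.
Implicit Types (A B : set G).

(** The form in which the non-commutator hypothesis enters the group theory: for fixed [g] it yields
    a sequence in [A] for the pigeonhole arguments. *)
Definition contains_powers e A := forall g n, A (g ^+ (e * n)).

(** This is the set [W] of the overview. Taking [B = A] covers the word without [v], with [s]
    lowered by one. *)
Fixpoint comm_values B A s : set G :=
  if s is s'.+1 then [set [~ x, a] | x in comm_values B A s' & a in A] else B.

Lemma comm_values_conj B A s :
  conj_closed B -> conj_closed A -> conj_closed (comm_values B A s).
Proof.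
move=> BJ AJ; elim: s => //= s IHs _ g [x vx [a Aa <-]].
rewrite conjRg; exists (x ^ g); first exact: IHs.
by exists (a ^ g) => //; exact: AJ.
Qed.

Lemma comm_values_iter B A s b a :
  B b -> A a -> comm_values B A s (iter s (@commg G ^~ a) b).
Proof.
move=> Bb Aa; elim: s => //= s IHs; exists (iter s (@commg G ^~ a) b) => //.
by exists a.
Qed.

Lemma comm_values_finite B A s e : (0 < e)%N ->
  conj_closed B -> conj_closed A -> contains_powers e B -> contains_powers e A ->
  finite_set (comm_values B A s) ->
  finite_set (generated_subgroup (comm_values B A s)).
Proof.
move=> e0 BJ AJ Be Ae finW.
have WJ := comm_values_conj (s := s) BJ AJ; apply: Dietzmann => //.
case: s => [|s] in finW WJ * => [b Bb|_ [x vx [a Aa <-]]].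
  by apply: (torsion_finite_powers finW e0) => n; exact: Be.
apply: (torsion_generator finW WJ e0) => [n||z Zz].
- by exists x => //; exists (a ^+ (e * n)) => //; exact: Ae.
- by exists x => //; exists a.
(* With [z ^+ (e * n)] as first entry and [a] as every other entry, the commutator is the
   [(e * n)]-th power of the one starting at [z], and it lies in [W]. *)
apply: (torsion_comm_iter (n := s) finW WJ) => //.
apply: (torsion_finite_powers finW e0) => n.
by rewrite -(center_iter_commX WJ) //; apply: (comm_values_iter s.+1).
Qed.

End CommutatorValues.

(** * Values of words *)

Lemma word_eval1 (X : choiceType) (G : groupType) (g : X -> G) :
  word_eval g 1 = 1.
Proof. by rewrite /word_eval big_nil. Qed.

Lemma word_evalV (X : choiceType) (G : groupType) (g : X -> G)
    (w : free_group X) :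
  word_eval g w^-1 = (word_eval g w)^-1.
Proof. by apply/esym/mulg1_eq; rewrite -word_evalM mulgV word_eval1. Qed.

Section WordValues.
Variables (X : choiceType) (G : groupType).
Implicit Types (w : free_group X) (g : X -> G).

Lemma word_eval_conj g w x : word_eval g w ^ x = word_eval (fun y => g y ^ x) w.
Proof.
rewrite /word_eval conjg_prod; apply: eq_bigr => a _.
by case: ifP; rewrite ?conjVg.
Qed.

(** Needed because each [u_i] is itself obtained by evaluating [u] in a free group. *)
Lemma word_eval_comp (Y : choiceType) (h : X -> free_group Y) (g : Y -> G) w :
  word_eval g (word_eval h w) = word_eval (fun x => word_eval g (h x)) w.
Proof.
rewrite [word_eval h w]/word_eval [RHS]/word_eval.
elim: (fg_seq w) => [|a s IHs]; first by rewrite !big_nil word_eval1.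
rewrite !big_cons word_evalM IHs; congr (_ * _).
by case: ifP => // _; apply: word_evalV.
Qed.

Lemma word_eval_left_normed g (ws : seq (free_group X)) :
  word_eval g (left_normed ws) = left_normed (map (word_eval g) ws).
Proof.
case: ws => [|w ws] /=; first exact: word_eval1.
elim/last_ind: ws => //= ws v IHws.
rewrite map_rcons !foldl_rcons -IHws !commgEl /conjg.
by rewrite !(word_evalM, word_evalV).
Qed.

Lemma word_values_conj w : conj_closed (word_values w (G := G)).
Proof.
by move=> _ y [g _ <-]; rewrite word_eval_conj; exists (fun x => g x ^ y).
Qed.

(** Sending all variables but [x] to 1 collapses [w] to a power of [y]; inverse letters are moved
    across so that exponents stay natural. *)
Lemma word_eval_single w x (y : G) :
  word_eval (fun z => if z == x then y else 1) w * y ^+ count_mem (x, true) w =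
  y ^+ count_mem (x, false) w.
Proof.
rewrite /word_eval; elim: (fg_seq w) => [|[z b] s IHs] /=.
  by rewrite big_nil mul1g.
rewrite big_cons /= !xpair_eqE; case: eqP => [_|_] /=; last first.
  by rewrite invg1 if_same mul1g.
case: b => /=; rewrite ?add0n ?add1n.
  by rewrite expgSr -mulgA (mulgA _ (y ^+ _)) IHs -expgSr expgS mulKg.
by rewrite -mulgA IHs -expgS.
Qed.

Lemma exponent_sum_count w x :
  exponent_sum x w = ((count_mem (x, false) w)%:Z - (count_mem (x, true) w)%:Z)%R.
Proof.
rewrite /exponent_sum; elim: (fg_seq w) => [|[z b] s IHs] /=.
  by rewrite big_nil.
rewrite big_cons /= IHs !xpair_eqE; case: eqP => [_|_] /=; last by rewrite !add0n.
by case: b => /=; rewrite ?expr1 ?expr0; lia.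
Qed.

Lemma word_values_powers w : noncommutator w ->
  exists2 e, (0 < e)%N & contains_powers e (word_values w (G := G)).
Proof.
move=> [x]; rewrite exponent_sum_count.
set p := count_mem (x, false) w; set q := count_mem (x, true) w => pq.
have val (y : G) :
    word_eval (fun z => if z == x then y else 1) w = y ^+ p * y ^- q.
  by rewrite -word_eval_single mulgK.
case: (leqP p q) => [le_pq|lt_qp].
  (* For a negative exponent sum the inverse power is substituted; [pq] rules out equality. *)
  exists (q - p)%N => [|y n]; first by lia.
  exists (fun z => if z == x then y ^- n else 1) => //.
  rewrite val !expVgn invgK -[in X in _ * X](subnKC le_pq) expgnDr mulKg.
  by rewrite -expgnA mulnC.
exists (p - q)%N => [|y n]; first by lia.
exists (fun z => if z == x then y ^+ n else 1) => //.
by rewrite val -expgnFr ?(ltnW lt_qp) // -!expgnA mulnC.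
Qed.

End WordValues.

(** * From sets of values to concise words *)

Lemma comm_valuesP (G : groupType) (B A : set G) s x :
  comm_values B A s x <-> exists b (t : seq G),
    [/\ B b, size t = s, (forall y, y \in t -> A y) & x = foldl (@commg G) b t].
Proof.
split.
  elim: s x => [|s IHs] x /=; first by move=> Bx; exists x, [::].
  move=> [y /IHs[b [t [Bb sz At ->]]] [a Aa <-]]; exists b, (rcons t a).
  split; rewrite ?size_rcons ?sz ?foldl_rcons // => z.
  by rewrite mem_rcons inE => /orP[/eqP->|/At].
move=> [b [t [Bb <- + ->]]]; elim/last_ind: t => //= t a IHt At.
rewrite size_rcons foldl_rcons; exists (foldl (@commg G) b t).
  by apply: IHt => y yt; apply: At; rewrite mem_rcons inE yt orbT.
by exists a => //; apply: At; rewrite mem_rcons mem_head.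
Qed.

(** The assignments [h i] are independent of each other, which reflects the disjoint variables of
    the [u_i]: the entries can be arbitrary values. *)
Lemma word_values_seq (X : choiceType) (w : free_group X) (G : groupType) s
    (t : seq G) :
  (exists h : 'I_s -> X -> G, t = [seq word_eval (h i) w | i <- enum 'I_s]) <->
  size t = s /\ forall y, y \in t -> word_values w y.
Proof.
split=> [[h ->]|[sz tw]].
  rewrite size_map size_enum_ord; split => // _ /mapP[i _ ->].
  by exists (h i).
have [i|h hP] := @boolp.choice 'I_s (X -> G)
    (fun i g => word_eval g w = nth 1 t i).
  have [|g _ <-] := tw (nth 1 t i); first by rewrite mem_nth // sz.
  by exists g.
exists h; rewrite (eq_map hP) (map_comp (nth 1 t) val) val_enum_ord -sz.
exact/esym/mkseq_nth.
Qed.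

Lemma concise_comm_values (X Y Z : choiceType) (u : free_group X)
    (v : free_group Y) (w : free_group Z) s :
  noncommutator u -> noncommutator v ->
  (forall G : groupType,
    word_values w (G := G) =
    comm_values (word_values v (G := G)) (word_values u (G := G)) s) ->
  concise w.
Proof.
move=> hu hv wE G; rewrite /verbal_subgroup wE.
have [e e0 ue] := word_values_powers G hu.
have [f f0 vf] := word_values_powers G hv.
(* The product of the two exponents serves both sets. *)
apply: (comm_values_finite (e := (e * f)%N)); rewrite ?muln_gt0 ?e0 //.
- exact: word_values_conj.
- exact: word_values_conj.
- by move=> g n; rewrite (mulnC e) -mulnA; exact: vf.
- by move=> g n; rewrite -mulnA; exact: ue.
Qed.

Theorem theorem1p3 (k l s : nat)
    (u : free_group 'I_k) (v : free_group 'I_l)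
    (hu : noncommutator u) (hv : noncommutator v) (hs : (0 < s)%N) :
  concise
    (left_normed
       [seq word_eval (fun j : 'I_k => fg_gen (j, i)) u | i <- enum 'I_s]) /\
  concise
    (left_normed
       (word_eval (fun m : 'I_l => fg_gen (inr m : 'I_k * 'I_s + 'I_l)%type) v
        :: [seq word_eval
                  (fun j : 'I_k => fg_gen (inl (j, i) : 'I_k * 'I_s + 'I_l)%type)
                  u | i <- enum 'I_s])).
Proof.
split.
(* The first entry [u_1] plays the role of [b], leaving one entry fewer. *)
- case: s hs => // s _; apply: (concise_comm_values (s := s) hu hu) => G.
  have evalE (g : 'I_k * 'I_s.+1 -> G) :
      word_eval g (left_normed
        [seq word_eval (fun j : 'I_k => fg_gen (j, i)) u | i <- enum 'I_s.+1]) =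
      left_normed [seq word_eval (fun j => g (j, i)) u | i <- enum 'I_s.+1].
    rewrite word_eval_left_normed -map_comp; congr left_normed.
    apply: eq_map => i /=; rewrite word_eval_comp; congr word_eval.
    by apply/funext => j; rewrite word_eval_gen.
  apply/seteqP; split => [_ [g _ <-]|x].
    rewrite evalE; set t := map _ _.
    have [|sz tu] := (word_values_seq u s.+1 t).1.
      by exists (fun i j => g (j, i)).
    apply/comm_valuesP; case: t sz tu => [//|b t] [sz] tu.
    exists b, t; split => //.
      exact/tu/mem_head.
    by move=> y yt; apply: tu; rewrite inE yt orbT.
  move=> /comm_valuesP[b [t [ub sz ut ->]]].
  have [|h bt] := (word_values_seq u s.+1 (b :: t)).2.
    by rewrite /= sz; split => // y; rewrite inE => /orP[/eqP->|/ut].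
  (* Distinct variables let the separate assignments be glued into one. *)
  exists (fun p => h p.2 p.1) => //; rewrite evalE.
  by rewrite -[RHS]/(left_normed (b :: t)) bt.
apply: (concise_comm_values (s := s) hu hv) => G.
have evalE (g : 'I_k * 'I_s + 'I_l -> G) :
    word_eval g (left_normed
       (word_eval (fun m : 'I_l => fg_gen (inr m : 'I_k * 'I_s + 'I_l)%type) v
        :: [seq word_eval
                  (fun j : 'I_k => fg_gen (inl (j, i) : 'I_k * 'I_s + 'I_l)%type)
                  u | i <- enum 'I_s])) =
    foldl (@commg G) (word_eval (fun m => g (inr m)) v)
      [seq word_eval (fun j => g (inl (j, i))) u | i <- enum 'I_s].
  rewrite word_eval_left_normed /= -map_comp word_eval_comp; congr foldl.
    by congr word_eval; apply/funext => m; rewrite word_eval_gen.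
  apply: eq_map => i /=; rewrite word_eval_comp; congr word_eval.
  by apply/funext => j; rewrite word_eval_gen.
apply/seteqP; split => [_ [g _ <-]|x].
  rewrite evalE; set t := map _ _; apply/comm_valuesP.
  have [|sz tu] := (word_values_seq u s t).1.
    by exists (fun i j => g (inl (j, i))).
  exists (word_eval (fun m => g (inr m)) v), t; split => //.
  by exists (fun m => g (inr m)).
move=> /comm_valuesP[_ [t [[g _ <-] sz ut ->]]].
have [//|h th] := (word_values_seq u s t).2.
exists (fun p => match p with inl q => h q.2 q.1 | inr m => g m end) => //.
by rewrite evalE th.
Qed.
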